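(* Let $0<\zeta<1/3$ be a constant and let $\mathbf{d}=\mathbf{d}(n)=(d_1,\dots,d_n)$ be degree sequences satisfying, for all $n$: (i) $\sum_{i=1}^n d_i=2m$ with $m$ a natural number; (ii) the minimum degree satisfies $\delta\ge 3$; (iii) the average degree $\theta=2m/n$ satisfies $\theta\le n^{\zeta}$; and (iv) any statement which fails with probability at most $n^{-\Omega(1)}$ for a configuration drawn from $\mathbb{CM}(\mathbf{d})$ holds with high probability when the configuration is conditioned on mapping to a simple graph. Let $G$ be chosen uniformly at random from $\mathcal{G}(\mathbf{d})$. Then with high probability $$\Phi(G)>\frac{1}{100}.$$
   Context: $\mathcal{G}(\mathbf{d})$ is the set of all simple graphs on vertex set $V=\{1,\dots,n\}$ in which vertex $i$ has degree $d_i$, with the uniform distribution. ''With high probability'' means with probability tending to $1$ as $n\to\infty$. Configuration model $\mathbb{CM}(\mathbf{d})$: attach $d_i$ distinguishable half-edges to each vertex $i$; a configuration is a perfect matching of the $2m$ half-edges, and $\mathbb{CM}(\mathbf{d})$ is the uniform distribution on all $(2m)!/(2^m m!)$ configurations. Each configuration maps to a (multi)graph on $V$ by turning every matched pair into an edge. Conditioned on mapping to a simple graph, the resulting graph is uniform on $\mathcal{G}(\mathbf{d})$. Explicitly, assumption (iv) says: for every sequence of events $A_n$ in $\mathbb{CM}(\mathbf{d}(n))$ with $\Pr(A_n)\ge 1-n^{-c}$ for some constant $c>0$ and all large $n$, one has $\Pr(A_n\mid \text{simple})\to 1$. Conductance: for $S\subseteq V$ let $d(S)=\sum_{v\in S}d(v)$,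 $\pi(S)=d(S)/(2m)$, and let $E(S:\overline S)$ be the number of edges with one end in $S$ and the other in $\overline S=V\setminus S$. Then $$\Phi(G)=\min_{\emptyset\ne S\subseteq V:\ \pi(S)\le 1/2}\frac{E(S:\overline S)}{d(S)}.$$ *)

(* Defs.v *)
From HB Require Import structures.
From mathcomp Require Import all_boot all_order all_algebra.
From mathcomp Require Import all_classical all_reals all_analysis.

Set Implicit Arguments.
Unset Strict Implicit.
Unset Printing Implicit Defensive.

Import Order.TTheory GRing.Theory Num.Theory.
Import numFieldNormedType.Exports.
Local Open Scope set_scope.
Local Open Scope ring_scope.

(* When Omega is empty the quotient is 0 / 0 = 0. *)
Definition uprob (R : realType) (T : finType) (Omega A : {set T}) : R :=
  #|Omega :&: A|%:R / #|Omega|%:R.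

Definition cond_uprob (R : realType) (T : finType) (Omega A B : {set T}) : R :=
  uprob R Omega (A :&: B) / uprob R Omega B.

Section Graphs.
Variable n : nat.

(* A simple graph on the vertex set 'I_n is represented by its edge set, a set
   of 2-element sets of vertices (see [simple_graph]). *)
Definition graph : finType := {set {set 'I_n}}.

Implicit Types (G : graph) (S : {set 'I_n}) (d : 'I_n -> nat).

Definition simple_graph G : bool := [forall e in G, #|e| == 2%N].

Definition deg G (v : 'I_n) : nat := #|[set e in G | v \in e]|.

Definition graphs_of_degrees d : {set graph} :=
  [set G : graph | simple_graph G && [forall v, deg G v == d v]].

Definition vol G S : nat := \sum_(v in S) deg G v.

Definition crossing G S : nat :=
  #|[set e in G | (e :&: S != finset.set0) && (e :&: ~: S != finset.set0)]|.

Definition edge_ratio (R : realType) G S : R := (crossing G S)%:R / (vol G S)%:R.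

Definition conductance_set (R : realType) G S : bool :=
  (S != finset.set0) && ((vol G S)%:R / (2 * #|G|)%:R <= 2^-1 :> R).

(* The seed 1 of the iterated minimum is an upper bound of every ratio, so as
   soon as some S is admissible this is the minimum of the ratios; see
   [conductance_le] and [conductance_attained]. *)
Definition conductance (R : realType) G : R :=
  \big[Order.min/1]_(S : {set 'I_n} | conductance_set R G S) edge_ratio R G S.

Lemma crossing_le_vol G S : (crossing G S <= vol G S)%N.
Proof.
apply: (@leq_trans #|\bigcup_(v in S) [set e in G | v \in e]|).
  apply/subset_leq_card/fintype.subsetP => e; rewrite inE => /and3P[eG /finset.set0Pn[v]].
  by rewrite inE => /andP[ve vS] _; apply/finset.bigcupP; exists v; rewrite ?inE ?eG.
rewrite /vol; apply: (big_ind2 (fun (A : {set {set 'I_n}}) k => #|A| <= k)%N).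
- by rewrite cards0.
- by move=> A k B l Ak Bl; rewrite (leq_trans (leq_card_setU A B).1) ?leq_add.
- by [].
Qed.

Lemma conductance_le (R : realType) G S :
  conductance_set R G S -> conductance R G <= edge_ratio R G S.
Proof. by move=> hS; exact: bigmin_le_cond. Qed.

Lemma conductance_attained (R : realType) G S : conductance_set R G S ->
  exists2 T, conductance_set R G T & conductance R G = edge_ratio R G T.
Proof.
move=> hS; rewrite /conductance (bigmin_eq_arg _ S) //.
  by case: arg_minP => // T hT _; exists T.
move=> T _; rewrite /edge_ratio; have := crossing_le_vol G T.
case: (vol G T) => [|k] h; first by rewrite invr0 mulr0.
by rewrite ler_pdivrMr ?ltr0n// mul1r ler_nat.
Qed.

End Graphs.

Section ConfigurationModel.
Variables (n : nat) (d : 'I_n -> nat).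

(* The half-edge [Tagged _ k] with tag i is the k-th half-edge at vertex i. *)
Definition half_edge : finType := {i : 'I_n & 'I_(d i)}.

(* A candidate configuration; the configurations are the members of [configs]. *)
Definition pairing : finType := {set {set half_edge}}.

Definition configs : {set pairing} :=
  [set M : pairing |
    finset.partition M [set: half_edge] && [forall p in M, #|p| == 2%N]].

Definition ends (p : {set half_edge}) : {set 'I_n} :=
  [set tag h | h in p].

(* The multigraph of M has no loop (every edge has two distinct ends) and no
   two parallel edges. *)
Definition maps_to_simple : {set pairing} :=
  [set M : pairing | [forall p in M, #|ends p| == 2%N] && dinjectiveb ends M].

End ConfigurationModel.

(* Every sequence of events that hold in the configuration
   model with probability at least 1 - n^{-c} for some constant c > 0 has
   probability tending to 1 given that the configuration maps to a simple
   graph. *)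
Definition transfers_to_simple (R : realType)
    (d : forall n : nat, 'I_n -> nat) : Prop :=
  forall A : forall n : nat, {set pairing (d n)},
    (exists2 c : R, 0 < c &
      (\forall n \near \oo,
         1 - (n%:R : R) `^ (- c) <= uprob R (configs (d n)) (A n))%classic) ->
    (cond_uprob R (configs (d n)) (A n) (maps_to_simple (d n))
       @[n --> \oo] --> (1 : R))%classic.

(* Main.v *)
Require Import Defs.
From HB Require Import structures.
From mathcomp Require Import all_boot all_order all_algebra.
From mathcomp Require Import all_classical all_reals all_analysis.
From mathcomp Require Import zify ring lra.

Set Implicit Arguments.
Unset Strict Implicit.
Unset Printing Implicit Defensive.

Import Order.TTheory GRing.Theory Num.Theory.
Import numFieldNormedType.Exports.
Local Open Scope classical_set_scope.
Local Open Scope ring_scope.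

(* Let N be the number of half-edges, so N >= 3 n, and let A be a set of D <= N / 2
   half-edges.  A uniform pairing is invariant under permutations of the
   half-edges, so the probability that A is cut at most D / 100 times equals, for
   one fixed pairing, the proportion of such sets among all C = 'C(N, D) sets of
   size D.  A set cut i times is determined by the (D + i) / 2 pairs that it meets
   and by the i points of these pairs that it misses; since C >= (N / D) ^ D >= 2 ^ D,
   there are at most C ^ (121 / 200) of them, and the probability is at most
   C ^ (- 79 / 200).  For the half-edges of s vertices, D >= 3 s gives
   C >= 'C(n, s) ^ 3 by Vandermonde's identity.  The exponent 3 * 79 / 200 exceeds 1,
   so the sum of these probabilities over all vertex sets is O(n ^ (- 1 / 6)).
   A simple configuration over a graph G is a bijective labelling, at each vertex v,
   of the half-edges at v by the edges of G at v; hence all graphs with the given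
   degrees have equally many configurations, and the bound passes to them. *)

(** * Pairings of a finite set and the pairs cut by a subset *)

Section PerfectMatchings.
Import boot.fintype boot.finset.
Variable T : finType.
Implicit Types (A B : {set T}) (M : {set {set T}}).
Local Open Scope nat_scope.
Local Open Scope set_scope.

(* [configs d] is convertible to [pairings [set: half_edge d]]. *)
Definition pairings A : {set {set {set T}}} :=
  [set M : {set {set T}} | partition M A && [forall p in M, #|p| == 2]].

Definition cut M A : nat :=
  #|[set p in M | (p :&: A != set0) && (p :&: ~: A != set0)]|.

Lemma pairingsP A M :
  reflect (partition M A /\ forall p, p \in M -> #|p| = 2) (M \in pairings A).
Proof.
rewrite inE; apply: (iffP andP) => -[PM h]; split => //.
  by move=> p pM; apply/eqP; move/forall_inP: h; apply.
by apply/forall_inP => p pM; rewrite h.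
Qed.

Lemma card_pairing A M : M \in pairings A -> #|A| = #|M| * 2.
Proof. by move=> /pairingsP[PM h]; exact: card_uniform_partition h PM. Qed.

Lemma pairing_exists A : ~~ odd #|A| -> exists M, M \in pairings A.
Proof.
move: {2}(#|A|) (leqnn #|A|) => k; elim: k A => [|k IH] A.
  rewrite leqn0 cards_eq0 => /eqP-> _; exists set0; apply/pairingsP; split.
    by rewrite partition_set0.
  by move=> p; rewrite inE.
move=> Ak odA; have [->|[x xA]] := set_0Vmem A.
  exists set0; apply/pairingsP; split; first by rewrite partition_set0.
  by move=> p; rewrite inE.
have cAx : #|A| = #|A :\ x|.+1 by rewrite (cardsD1 x) xA.
have [A0|[y yA]] := set_0Vmem (A :\ x).
  by move: odA; rewrite cAx A0 cards0.
have cAy : #|A| = #|A :\ x :\ y|.+2 by rewrite cAx (cardsD1 y) yA.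
have [||M /pairingsP[PM cM]] := IH (A :\ x :\ y).
- by move: Ak; rewrite cAy ltnS => /ltnW.
- by move: odA; rewrite cAy /= negbK.
move: yA; rewrite !inE => /andP[yx yA].
exists ([set x; y] |: M); apply/pairingsP; split; last first.
  move=> p; rewrite !inE => /orP[/eqP->|/cM//].
  by rewrite cards2 eq_sym yx.
have -> : A = [set x; y] :|: (A :\ x :\ y).
  apply/setP => z; rewrite !inE.
  by case: eqVneq => [->|_]//=; case: eqVneq => [->|].
apply: partitionU1 => //; first by apply/set0Pn; exists x; rewrite !inE eqxx.
rewrite -setI_eq0; apply/eqP/setP => z; rewrite !inE.
by case: (z == x); case: (z == y).
Qed.

(** Each pair met by [A] has two points: its points in [A], and one more exactly when the pair is
    cut. *)
Lemma cardsI_cut M A : M \in pairings [set: T] ->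
  #|cover [set p in M | p :&: A != set0]| = #|A| + cut M A.
Proof.
move=> /pairingsP[PM cM]; set W := [set p in M | _].
have WM : W \subset M by apply/subsetP => p; rewrite inE => /andP[].
have tW : trivIset W := trivIsetS WM (partition_trivIset PM).
have -> : #|cover W| = \sum_(p in W) #|p|.
  by apply/eqP; rewrite (leq_card_cover W).2.
have -> : #|A| = \sum_(p in W) #|p :&: A|.
  rewrite -sum1_card (eq_bigl (fun x => (x \in [set: T]) && (x \in A))); last first.
    by move=> x; rewrite inE.
  rewrite (set_partition_big_cond M PM) /= [RHS]big_mkcond /= [LHS]big_mkcond /=.
  apply: eq_bigr => p _; rewrite inE; case: (p \in M) => //=.
  rewrite -sum1_card; case: ifPn => [_|].
    by apply: eq_bigl => x; rewrite inE.
  rewrite negbK => /eqP pA0.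
  rewrite (eq_bigl (fun x => x \in set0)) ?big_set0 // => x.
  by rewrite -pA0 inE.
have -> : cut M A = \sum_(p in W) (p :&: ~: A != set0).
  rewrite /cut -sum1_card big_mkcond [RHS]big_mkcond /=; apply: eq_bigr => p _.
  by rewrite !inE; case: (p \in M) => //=; case: (_ != _) => //=; case: (_ != _).
rewrite -big_split; apply: eq_bigr => p; rewrite inE => /andP[pM pA].
have := cM _ pM; rewrite -{1}(cardsID A p) setDE (cM _ pM).
rewrite -card_gt0 in pA; rewrite -card_gt0.
case: #|p :&: ~: A| => [|l]; first by rewrite /= !addn0 => ->.
by case: #|p :&: A| pA => [|[|k]] //= _; rewrite addnS.
Qed.

End PerfectMatchings.

(** * Counting the sets that a fixed pairing cuts few times *)

Section CutCounting.
Import boot.fintype boot.finset.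
Local Open Scope nat_scope.
Local Open Scope set_scope.

Lemma card_bigcup_le (I T : finType) (P : pred I) (F : I -> {set T}) :
  #|\bigcup_(i | P i) F i| <= \sum_(i | P i) #|F i|.
Proof.
apply: (big_ind2 (fun (A : {set T}) k => #|A| <= k)); rewrite ?cards0 // => A k B l Ak Bl.
by rewrite (leq_trans (leq_card_setU A B).1) ?leq_add.
Qed.

Variable T : finType.
Implicit Types (A W : {set T}) (M : {set {set T}}).
Notation pairings := (@pairings T).

Lemma card_few_cut M D k b : M \in pairings [set: T] ->
  (forall i j, i <= k -> j * 2 = D + i -> 'C(#|M|, j) * 'C(D + i, i) <= b) ->
  #|[set A : {set T} | (#|A| == D) && (cut M A <= k)]| <= k.+1 * b.
Proof.
(* A is encoded by the set W of the pairs it meets and by Y = cover W :\: A, whose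
   size is the number of cut pairs. *)
move=> MP hb; have /pairingsP[PM cM] := MP.
pose F i := [set WY : {set {set T}} * {set T} |
  [&& WY.1 \subset M, #|WY.1| * 2 == D + i, WY.2 \subset cover WY.1 & #|WY.2| == i]].
pose f (WY : {set {set T}} * {set T}) := cover WY.1 :\: WY.2.
apply: (@leq_trans #|\bigcup_(i < k.+1) f @: F i|).
  apply/subset_leq_card/subsetP => A; rewrite inE => /andP[/eqP cA cutk].
  apply/bigcupP; exists (Ordinal (cutk : cut M A < k.+1)) => //.
  have := cardsI_cut A MP; set W := [set p in M | _] => cW.
  have WM : W \subset M by apply/subsetP => p; rewrite inE => /andP[].
  have AW : A \subset cover W.
    apply/subsetP => x xA.
    have xM : x \in cover M by rewrite (cover_partition PM) inE.
    apply/bigcupP; exists (pblock M x); last by rewrite mem_pblock.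
    rewrite inE pblock_mem //=; apply/set0Pn; exists x.
    by rewrite inE mem_pblock xM.
  have cW2 : #|cover W| = #|W| * 2.
    have /eqP -> : #|cover W| == \sum_(p in W) #|p|.
      by rewrite (leq_card_cover W).2 (trivIsetS WM) ?(partition_trivIset PM).
    rewrite -sum_nat_const; apply: eq_bigr => p pW.
    by apply: cM; apply: (subsetP WM).
  apply/imsetP; exists (W, cover W :\: A); last first.
    by rewrite /f /= setDDr setDv set0U; exact/esym/setIidPr.
  rewrite inE /= WM -cW2 cW cA eqxx subsetDl /=.
  by rewrite cardsD (setIidPr AW) cW addKn.
apply: (leq_trans (card_bigcup_le _ _)).
rewrite -[k.+1 in leqRHS]card_ord -sum_nat_const.
apply: leq_sum => i _; apply: (leq_trans (leq_imset_card _ _)).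
pose Ws := [set W : {set {set T}} | (W \subset M) && (#|W| * 2 == D + i)].
pose Ys (W : {set {set T}}) := [set Y : {set T} | (Y \subset cover W) && (#|Y| == i)].
have -> : F i = \bigcup_(W in Ws) [set (W, Y) | Y in Ys W].
  apply/setP => -[W Y]; rewrite inE /=.
  apply/and4P/bigcupP => [[h1 h2 h3 h4]|[W']].
    by exists W; rewrite ?imset_f // inE ?h1 ?h2 ?h3 ?h4.
  by rewrite inE => /andP[h1 h2] /imsetP[Y']; rewrite inE => /andP[h3 h4] [-> ->].
apply: (leq_trans (card_bigcup_le _ _)).
apply: (@leq_trans (\sum_(W in Ws) 'C(D + i, i))).
  apply: leq_sum => W; rewrite inE => /andP[WM /eqP cW].
  apply: (leq_trans (leq_imset_card _ _)); rewrite cards_draws.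
  apply: leq_bin2l; rewrite -cW; apply: (leq_trans (leq_card_cover W)).
  by rewrite -sum_nat_const leq_sum // => p pW; rewrite cM //; apply: (subsetP WM).
(* [hb] needs a value of [j]: any member of [Ws] supplies it, its size being forced by [D + i]; an
   empty [Ws] makes the product zero. *)
rewrite sum_nat_const; have [->//|[W0]] := set_0Vmem Ws; first by rewrite cards0.
rewrite inE => /andP[_ /eqP W0D].
apply: leq_trans (hb i #|W0| (leq_ord i) W0D); rewrite leq_mul2r; apply/orP; right.
rewrite -cards_draws; apply/subset_leq_card/subsetP => W.
by rewrite !inE => /andP[-> /eqP h]; rewrite -(eqn_pmul2r (isT : 0 < 2)) h W0D /=.
Qed.

End CutCounting.

(** * Averaging over permutations of the points *)

Section Symmetry.
Local Open Scope nat_scope.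
Local Open Scope set_scope.
Import boot.fintype boot.finset.
Variable T : finType.
Implicit Types (A B : {set T}) (M : {set {set T}}).

(** List [A] before its complement and [B] before its complement; [g] sends each point to the one at
    the same position. *)
Lemma imset_onto A B : #|A| = #|B| -> exists2 g : T -> T, injective g & g @: A = B.
Proof.
move=> cAB; have [x0|T0] := pickP (@predT T); last first.
  by exists id => //; apply/setP => x; have := T0 x.
pose sA := enum A ++ enum (~: A); pose sB := enum B ++ enum (~: B).
have sAP x : x \in sA by rewrite mem_cat !mem_enum inE orbN.
have uniqE (C : {set T}) : uniq (enum C ++ enum (~: C)).
  rewrite cat_uniq !enum_uniq andbT /=; apply/hasPn => x.
  by rewrite !mem_enum inE.
have szE : size sA = size sB.
  rewrite !size_cat -!cardE cAB; congr (_ + _)%N.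
  by rewrite [LHS]cardsCs [RHS]cardsCs !setCK cAB.
pose g x := nth x0 sB (index x sA).
have ginj : injective g.
  move=> x y /eqP; rewrite nth_uniq ?uniqE -?szE ?index_mem // => /eqP.
  by apply: index_inj.
exists g => //; apply/eqP; rewrite eqEcard card_imset // cAB leqnn andbT.
apply/subsetP => _ /imsetP[x xA ->]; rewrite /g /sA /sB index_cat mem_enum xA.
have ltx : index x (enum A) < size (enum B).
  by rewrite -cardE -cAB cardE index_mem mem_enum.
by rewrite nth_cat ltx -mem_enum mem_nth.
Qed.

Lemma imset_pairing (g : T -> T) M : injective g ->
  M \in pairings [set: T] -> [set g @: (p : {set T}) | p in M] \in pairings [set: T].
Proof.
move=> ginj /pairingsP[PM cM]; apply/pairingsP; split.
  have -> : [set: T] = g @: [set: T].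
    by apply/esym/eqP; rewrite eqEcard subsetT card_imset ?leqnn.
  by rewrite imset_partition.
by move=> _ /imsetP[p pM ->]; rewrite card_imset // cM.
Qed.

Lemma cut_imset (g : T -> T) M A : injective g ->
  cut [set g @: (p : {set T}) | p in M] (g @: A) = cut M A.
Proof.
move=> ginj.
have gC : ~: (g @: A) = g @: (~: A).
  apply/esym/eqP; rewrite eqEcard (card_imset _ ginj).
  rewrite [leqLHS]cardsCs [leqRHS]cardsCs !setCK card_imset // leqnn andbT.
  apply/subsetP => _ /imsetP[x xA ->].
  by rewrite inE mem_imset // -in_setC.
rewrite /cut -[RHS](card_imset _ (imset_inj ginj)); apply: eq_card => q.
have gI (p B : {set T}) : (g @: p :&: g @: B != set0) = (p :&: B != set0).
  by rewrite -imsetI ?imset_eq0 // => ? ? _ _ /ginj.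
apply/idP/imsetP => [|[p pMA ->]].
  rewrite inE => /andP[/imsetP[p pM ->]]; rewrite gC !gI => h.
  by exists p; rewrite // inE pM.
by move: pMA; rewrite !inE gC !gI => /andP[pM ->]; rewrite imset_f.
Qed.

(** Double counting of the pairs [(M, B)] with [#|B| = #|A|] and [cut M B <= k]. A permutation
    taking [A] to [B] carries pairings to pairings and preserves cuts, so each [B] occurs with at
    least as many [M] as [A] does; each [M] occurs with at most [K] sets. *)
Lemma card_few_cut_pairings A k K :
  (forall M, M \in pairings [set: T] ->
     #|[set B : {set T} | (#|B| == #|A|) && (cut M B <= k)]| <= K) ->
  #|[set M in pairings [set: T] | cut M A <= k]| * 'C(#|T|, #|A|) <=
  #|pairings [set: T]| * K.
Proof.
move=> hK; pose S := [set B : {set T} | #|B| == #|A|].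
pose F B := [set M in pairings [set: T] | cut M B <= k].
rewrite -card_draws -/S -/(F A) mulnC -(sum_nat_const (mem S)).
apply: (@leq_trans (\sum_(B in S) #|F B|)).
  apply: leq_sum => B; rewrite inE => /eqP cB.
  have [g ginj <-] := imset_onto (esym cB).
  pose gM M := [set g @: (p : {set T}) | p in M].
  have gMinj : injective gM by apply/imset_inj/imset_inj.
  rewrite -(card_imset (mem (F A)) gMinj); apply: subset_leq_card.
  apply/subsetP => M' /imsetP[M MF ->]; move: MF; rewrite inE => /andP[MP h].
  by rewrite inE imset_pairing // cut_imset.
have -> : \sum_(B in S) #|F B| =
    \sum_(M in pairings [set: T]) \sum_(B in S) (cut M B <= k).
  rewrite exchange_big; apply: eq_bigr => B _.
  rewrite -sum1_card big_mkcond [RHS]big_mkcond; apply: eq_bigr => M _ /=.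
  by rewrite inE; case: (_ \in _) => //=; case: (_ <= _).
rewrite -sum_nat_const; apply: leq_sum => M MP; apply: leq_trans (hK _ MP).
rewrite -sum1_card big_mkcond [leqRHS]big_mkcond; apply: leq_sum => B _ /=.
by rewrite !inE; case: eqP => //= _; case: (_ <= _).
Qed.

End Symmetry.

(** * Estimates for binomial coefficients *)

Section BinomialBounds.
Local Open Scope nat_scope.

Lemma leq_bin_mul k l a b : 'C(k, a) * 'C(l, b) <= 'C(k + l, a + b).
Proof.
rewrite -binomial.Vandermonde.
have ha : a < (a + b).+1 by rewrite ltnS leq_addr.
by rewrite (bigD1 (Ordinal ha)) //= addKn leq_addr.
Qed.

Lemma leq_bin_half n a b : a <= b -> b * 2 <= n -> 'C(n, a) <= 'C(n, b).
Proof.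
elim: b => [|b IH]; first by rewrite leqn0 => /eqP->.
rewrite leq_eqVlt => /orP[/eqP->//|]; rewrite ltnS => ab bn.
apply: (@leq_trans 'C(n, b)); first by apply: IH => //; lia.
rewrite -(@leq_pmul2l b.+1) // mul_bin_left leq_mul2r; lia.
Qed.

(** Division-free form of the lower bound [(n / k) ^ k]. The induction lowers [n] and [k] together
    and uses [(n + 1) / (k + 1) <= n / k] for [0 < k <= n]. *)
Lemma exp_leq_bin n k : k <= n -> n ^ k <= 'C(n, k) * k ^ k.
Proof.
elim: k n => [|k IH] [|n] //=.
rewrite ltnS => kn; case: k => [|k] in IH kn *; first by rewrite !expn1 bin1 muln1.
set K := k.+1 in IH kn *.
have := IH n kn; set x := 'C(n, K) => h.
have e : K.+1 * 'C(n.+1, K.+1) = n.+1 * x by rewrite -mul_bin_diag.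
have le1 : n.+1 ^ K * K ^ K <= n ^ K * K.+1 ^ K.
  by rewrite -!expnMn leq_exp2r //; nia.
rewrite -(@leq_pmul2r (K ^ K)) ?expn_gt0 //.
rewrite [K.+1 ^ K.+1]expnS mulnA [_ * K.+1]mulnC e.
rewrite [n.+1 ^ K.+1]expnS -!mulnA leq_mul2l /=.
apply: (leq_trans le1); rewrite mulnC [in leqRHS]mulnCA leq_mul2l.
by rewrite h orbT.
Qed.

(** Raising the lower index from [k + i] to [k + i + 1] multiplies the coefficient by
    [(n - k - i) / (k + i + 1)], at most [n / k]. *)
Lemma bin_add_leq n k i : 'C(n, k + i) * k ^ i <= 'C(n, k) * n ^ i.
Proof.
elim: i => [|i IH]; first by rewrite addn0 !expn0.
have := mul_bin_left n (k + i); rewrite -addnS => e.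
rewrite !expnSr !mulnA; apply: (@leq_trans ('C(n, k + i) * k ^ i * n)).
  2: by rewrite leq_mul2r IH orbT.
rewrite [leqLHS]mulnAC [leqRHS]mulnAC leq_mul2r [_ * n]mulnC; apply/orP; right.
apply: (@leq_trans ((k + i.+1) * 'C(n, k + i.+1))).
  by rewrite mulnC leq_mul2r; lia.
by rewrite e leq_mul2r leq_subr orbT.
Qed.

Lemma bin_exp_leq n k x : 'C(n, k) * x ^ (n - k) <= x.+1 ^ n.
Proof.
have [kn|nk] := leqP k n; last by rewrite bin_small.
rewrite -[x.+1]addn1 expnDn.
have hk : k < n.+1 by [].
by rewrite (bigD1 (Ordinal hk)) //= exp1n muln1 leq_addr.
Qed.

Lemma leq_exp2rW a b e : a <= b -> a ^ e <= b ^ e.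
Proof. by case: e => // e ab; rewrite leq_exp2r. Qed.

(** The integer part of the [e]-th root of [x], which stands in for fractional powers in
    natural-number arithmetic. *)
Lemma nat_root_exists x e : 0 < e ->
  exists2 b, b ^ e <= x & forall t, t ^ e <= x -> t <= b.
Proof.
move=> e0; have [|t tx|b bx bmax] := @ex_maxnP (fun t => t ^ e <= x) x.
- by exists 0; rewrite exp0n.
- apply: leq_trans tx; case: t => // t; case: e e0 => // e _.
  by rewrite expnS leq_pmulr ?expn_gt0.
by exists b.
Qed.

Section CentralBinomial.
Variables (n k : nat).
Hypothesis kn : k * 2 <= n.

Lemma exp2_leq_bin : 2 ^ k <= 'C(n, k).
Proof.
case: (posnP k) => [->|k0]; first by rewrite expn0 bin0.
rewrite -(@leq_pmul2r (k ^ k)) ?expn_gt0 ?k0 // -expnMn.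
apply: leq_trans (exp_leq_bin _); last by lia.
by rewrite leq_exp2r //; lia.
Qed.

(** The increment [i] costs a factor at most [(n / k) ^ i], whose 100th power is at most
    [(n / k) ^ k <= 'C(n, k)]. *)
Lemma bin_add_exp i : 100 * i <= k -> 'C(n, k + i) ^ 100 <= 'C(n, k) ^ 101.
Proof.
move=> ik; case: (posnP k) => [k0|k0].
  by move: ik; rewrite k0 leqn0 muln_eq0 => /eqP->; rewrite bin0 !exp1n.
have h : n ^ (100 * i) <= 'C(n, k) * k ^ (100 * i).
  rewrite -(@leq_pmul2r (k ^ (k - 100 * i))) ?expn_gt0 ?k0 //.
  rewrite -mulnA -expnD subnKC //; apply: leq_trans (exp_leq_bin _); last by lia.
  rewrite -[in leqRHS](subnKC ik) [in leqRHS]expnD leq_mul2l.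
  by apply/orP; right; apply: leq_exp2rW; lia.
rewrite -(@leq_pmul2r (k ^ (100 * i))) ?expn_gt0 ?k0 //.
apply: (@leq_trans ('C(n, k) ^ 100 * n ^ (100 * i))).
  rewrite [100 * i]mulnC !expnM -!expnMn leq_exp2r //; exact: bin_add_leq.
by rewrite [in leqRHS]expnSr -mulnA leq_mul2l h orbT.
Qed.

Lemma bin_small_exp i : 100 * i <= k -> 'C(k + i, i) ^ 100 <= 'C(n, k) ^ 9.
Proof.
(* [512 = 2 ^ 9] is a power of 2 above [101 ^ 101 / 100 ^ 100], about 273. This quotient comes from
   the bound [101 ^ (k + i) / 100 ^ k] on the coefficient, raised to the power 100. *)
move=> ik; apply: (@leq_trans (512 ^ k)); last first.
  by rewrite (_ : 512 = 2 ^ 9) // -expnM mulnC expnM leq_exp2r ?exp2_leq_bin.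
have := bin_exp_leq (k + i) i 100; rewrite addnK => h.
rewrite -(@leq_pmul2r (100 ^ (100 * k))) ?expn_gt0 //.
rewrite -[100 * k]mulnC expnM -expnMn.
apply: (@leq_trans (101 ^ (101 * k))).
  apply: (@leq_trans ((101 ^ (k + i)) ^ 100)); first by rewrite leq_exp2r.
  by rewrite -expnM leq_exp2l //; lia.
rewrite expnM -[(100 ^ k) ^ 100]expnM [k * 100]mulnC [100 ^ (100 * k)]expnM -expnMn.
by apply: leq_exp2rW; lia.
Qed.

Lemma succ_exp_leq_bin i : 100 * i <= k -> i.+1 ^ 100 <= 'C(n, k).
Proof.
move=> ik; apply: (@leq_trans (2 ^ k)); last exact: exp2_leq_bin.
apply: (@leq_trans ((2 ^ i) ^ 100)); first by rewrite leq_exp2r // ltn_expl.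
by rewrite -expnM leq_exp2l //; lia.
Qed.

End CentralBinomial.

End BinomialBounds.

(** * Probability that one set of half-edges is cut few times *)

Section FewCutBound.
Local Open Scope nat_scope.
Local Open Scope set_scope.
Import boot.fintype boot.finset.
Variable T : finType.

Lemma card_few_cut_bound (A : {set T}) : #|A| * 2 <= #|T| ->
  #|[set M in pairings [set: T] | 100 * cut M A <= #|A|]| ^ 200 *
    'C(#|T|, #|A|) ^ 79 <= #|pairings [set: T]| ^ 200.
Proof.
(* With C = 'C(N, D), each 'C(#|M|, j) is at most C ^ (101 / 200), each 'C(D + i, i)
   at most C ^ (9 / 100), and D %/ 100 + 1 at most C ^ (1 / 100). *)
move=> A2; have C0 : 0 < 'C(#|T|, #|A|) by rewrite bin_gt0; lia.
move: C0; set C := 'C(#|T|, #|A|); set k := #|A| %/ 100 => C0.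
have k100 i : (100 * i <= #|A|) = (i <= k) by rewrite leq_divRL // mulnC.
(* [b] is the integer part of [C ^ (119 / 200)]; [119 = 101 + 2 * 9] combines the exponents of the
   two binomial factors. *)
have [b bC bmax] := nat_root_exists (C ^ 119) (isT : 0 < 200).
have -> : [set M in pairings [set: T] | 100 * cut M A <= #|A|] =
          [set M in pairings [set: T] | cut M A <= k].
  by apply/setP => M; rewrite !inE k100.
set bad := #|_|; set pm := #|pairings _|.
have h : bad * C <= pm * (k.+1 * b).
  apply: card_few_cut_pairings => M MP; apply: (card_few_cut MP) => i j ik jD.
  rewrite -k100 in ik; apply: bmax; rewrite expnMn.
  have -> : C ^ 119 = C ^ 101 * (C ^ 9) ^ 2 by rewrite -expnM -expnD.
  apply: leq_mul.
    (* Vandermonde bounds ['C(#|M|, j) ^ 2] by ['C(2 * #|M|, 2 * j)], which is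
       ['C(#|T|, #|A| + i)]. *)
    apply: leq_trans (bin_add_exp A2 ik).
    rewrite (expnM _ 2 100) leq_exp2r // -jD expnS expn1.
    have := card_pairing MP; rewrite cardsT => ->.
    by rewrite !muln2 -!addnn; exact: leq_bin_mul.
  by rewrite (expnM _ 100 2) leq_exp2r //; exact: bin_small_exp.
have h200 := leq_exp2rW 200 h; rewrite !expnMn in h200.
(* In 200th powers, [k.+1] costs [C ^ 2] and [b] costs [C ^ 119]; the other 79 of the 200 factors
   [C] remain on the left. *)
rewrite -(@leq_pmul2r (C ^ 121)) ?expn_gt0 ?C0 // -mulnA -expnD.
apply: (leq_trans h200); rewrite leq_mul2l; apply/orP; right.
rewrite (expnD _ 2 119) leq_mul // (expnM _ 100 2) leq_exp2r //.
by apply: succ_exp_leq_bin => //; rewrite k100.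
Qed.

End FewCutBound.

(** * Expansion of configurations over vertex sets *)

Section Expansion.
Import boot.fintype boot.finset.
Variables (n : nat) (d : 'I_n -> nat).
Local Open Scope nat_scope.
Local Open Scope set_scope.

Definition half_edges_of (S : {set 'I_n}) : {set half_edge d} :=
  [set h | tag h \in S].

(** The event to be transferred: the conductance condition read on half-edges, with the ratios 1/2
    and 1/100 cleared of denominators. *)
Definition expanding : {set pairing d} :=
  [set M | [forall S : {set 'I_n},
     (S != set0) && (#|half_edges_of S| * 2 <= #|half_edge d|) ==>
     (#|half_edges_of S| < 100 * cut M (half_edges_of S))]].

Lemma card_half_edges_of S : #|half_edges_of S| = \sum_(v in S) d v.
Proof.
rewrite -sum1_card (partition_big (fun h : half_edge d => tag h) (mem S)) /=; last first.
  by move=> h; rewrite inE.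
apply: eq_bigr => v vS; rewrite -(card_ord (d v)) sum1_card.
rewrite -(card_in_imset (f := fun k : 'I_(d v) => Tagged (fun i => 'I_(d i)) k)).
  apply: eq_card => h; rewrite unfold_in inE /=; apply/andP/imsetP => [[]|].
    move=> _ /eqP; case: h => w k /= wv; subst w.
    by exists k; rewrite ?inE.
  by case=> k _ ->; rewrite /= vS eqxx.
by move=> k l _ _ /eqP; rewrite eq_Tagged => /eqP.
Qed.

Lemma card_half_edge : #|half_edge d| = \sum_(v < n) d v.
Proof.
have := card_half_edges_of setT; rewrite (_ : half_edges_of setT = setT).
  by rewrite cardsT => ->; apply: eq_bigl => v; rewrite inE.
by apply/setP => h; rewrite !inE.
Qed.

Hypothesis d3 : forall v, 3 <= d v.

(** The probability is at most [C ^ (- 79 / 200)] with [C >= 'C(n, #|S|) ^ 3], and [237 / 200]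
    exceeds [7 / 6]. The excess [1 / 6] over 1 is what survives the union bound. *)
Lemma card_few_cut_vertices (S : {set 'I_n}) :
  #|half_edges_of S| * 2 <= #|half_edge d| ->
  #|[set M in configs d | 100 * cut M (half_edges_of S) <= #|half_edges_of S| ]| ^ 6 *
    'C(n, #|S|) ^ 7 <= #|configs d| ^ 6.
Proof.
move=> S2; have := card_few_cut_bound S2.
rewrite -[pairings _]/(configs d); set bad := #|_|; set pm := #|configs d|.
set C := 'C(_, _) => h; set Cs := 'C(_, _).
have Cs0 : 0 < Cs by rewrite bin_gt0 -[n in leqRHS]card_ord max_card.
have CsC : Cs ^ 3 <= C.
  have s3 : 3 * #|S| <= #|half_edges_of S|.
    by rewrite card_half_edges_of mulnC -sum_nat_const leq_sum.
  have n3 : 3 * n <= #|half_edge d|.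
    by rewrite card_half_edge mulnC -[n in n * 3]card_ord -sum_nat_const leq_sum.
  apply: leq_trans (leq_bin_half s3 S2); apply: leq_trans (leq_bin2l _ n3).
  rewrite !mulSn !mul0n !addn0 !expnS expn0 muln1.
  apply: leq_trans (leq_bin_mul _ _ _ _); rewrite leq_mul2l; apply/orP; right.
  exact: leq_bin_mul.
rewrite -(@leq_exp2r _ _ 100) // expnMn -!expnM.
apply: (@leq_trans ((bad ^ 200 * C ^ 79) ^ 3)); last first.
  by rewrite (_ : 6 * 100 = 200 * 3) // expnM leq_exp2r.
rewrite expnMn -!expnM leq_mul2l; apply/orP; right.
apply: (@leq_trans ((Cs ^ 3) ^ (79 * 3))); last by rewrite leq_exp2r.
by rewrite -expnM; apply: leq_pexp2l.
Qed.

End Expansion.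

(** * Union bound over vertex sets *)

Section ExpansionProbability.
Import boot.fintype boot.finset.
Variables (R : realType) (n : nat) (d : 'I_n -> nat).
Hypotheses (n24 : (24 <= n)%N) (d3 : forall v, (3 <= d v)%N).
Hypothesis even_sum : ~~ odd (\sum_(v < n) d v).
Local Open Scope set_scope.

(* Bounds the contribution of the vertex sets of size s; it is at least
   'C(n, s) ^ (- 1 / 6), because 'C(n, s) >= n for 0 < s < n and
   'C(n, s) >= (n / 12) ^ 12 in the middle range. *)
Definition tail_weight (s : nat) : R :=
  if (12 <= s)%N && (s + 12 <= n)%N then 144 / n%:R ^+ 2 else n%:R `^ (- 6^-1).

Let n_gt0 : 0 < n%:R :> R.
Proof. by rewrite ltr0n; lia. Qed.

Lemma tail_weight_gt0 s : 0 < tail_weight s.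
Proof.
by rewrite /tail_weight; case: ifP => _; rewrite ?divr_gt0 ?exprn_gt0 ?powR_gt0.
Qed.

Lemma tail_weight_bin s : (0 < s < n)%N -> 1 <= tail_weight s ^+ 6 * 'C(n, s)%:R.
Proof.
move=> /andP[s0 sn]; rewrite /tail_weight; case: ifPn => [/andP[s12 sn12]|_].
  have hC : ('C(n, 12) <= 'C(n, s))%N.
    have [s2|s2] := leqP (s * 2) n; first by apply: leq_bin_half.
    rewrite -[leqRHS]bin_sub; last by lia.
    by apply: leq_bin_half; lia.
  have := exp_leq_bin (leq_trans (isT : 12 <= 24)%N n24).
  rewrite -(ler_nat R) natrM !natrX => h.
  (* [(144 / n ^ 2) ^ 6 = (12 / n) ^ 12] is the reciprocal of the lower bound for ['C(n, 12)]. *)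
  apply: (@le_trans _ _ ((144 / n%:R ^+ 2) ^+ 6 * 'C(n, 12)%:R)).
    rewrite expr_div_n -exprM -mulrA mulrC -mulrA.
    rewrite ler_pdivlMl ?exprn_gt0 // mulr1; apply: (le_trans h).
    by rewrite (_ : 144 = 12%:R ^+ 2) -?exprM ?lexx // -natrX.
  by rewrite ler_wpM2l ?ler_nat // exprn_ge0 // ltW // divr_gt0 ?exprn_gt0.
rewrite -powR_mulrn ?powR_ge0 // -powRrM mulNr mulVf ?pnatr_eq0 // (powR_inv1 (ltW n_gt0)).
rewrite ler_pdivlMl // mulr1 ler_nat.
have := @leq_bin_half n 1 (minn s (n - s)); rewrite bin1.
have -> : 'C(n, minn s (n - s)) = 'C(n, s).
  by case: (leqP s (n - s)) => // _; rewrite bin_sub // ltnW.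
by apply; lia.
Qed.

(** At most 24 sizes lie near 0 or [n], each of weight [n ^ (- 1 / 6)]. The others have total weight
    at most [144 * (n + 1) / n ^ 2 <= 288 / n], and [288 + 24 = 312]. *)
Lemma sum_tail_weight : \sum_(s < n.+1) tail_weight s <= 312 * n%:R `^ (- 6^-1).
Proof.
have h (s : 'I_n.+1) : tail_weight s <=
    144 / n%:R ^+ 2 + n%:R `^ (- 6^-1) * ((s < 12)%N + (n < s + 12)%N)%:R.
  rewrite /tail_weight; case: ifPn => [_|].
    by rewrite lerDl mulr_ge0 // powR_ge0.
  rewrite negb_and -!ltnNge => h.
  rewrite -[leLHS]add0r lerD ?divr_ge0 ?exprn_ge0 //.
  rewrite ler_peMr ?powR_ge0 // (ler_nat _ 1).
  by case/orP: h => ->; rewrite ?addnS.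
apply: (le_trans (ler_sum _ (fun s _ => h s))).
rewrite big_split /= sumr_const card_ord -mulr_sumr -natr_sum.
have c12 m : (\sum_(s < m) (s < 12) = minn m 12)%N.
  by elim: m => [|m IH]; rewrite ?big_ord0 // big_ord_recr /= IH; lia.
have c24 : (\sum_(s < n.+1) ((s < 12) + (n < s + 12)) <= 24)%N.
  rewrite big_split /= (_ : 24 = 12 + 12)%N // leq_add ?c12 ?geq_minr //.
  rewrite (reindex_inj rev_ord_inj) /=.
  rewrite (eq_bigr (fun s : 'I_n.+1 => nat_of_bool (s < 12)%N)) ?c12 ?geq_minr //.
  by move=> s _; congr (nat_of_bool _); have := ltn_ord s; rewrite /=; lia.
have ninv : n%:R^-1 <= n%:R `^ (- 6^-1) :> R.
  rewrite -(powR_inv1 (ltW n_gt0)) ler_powR ?ler1n; [by []|lia|lra].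
apply: (@le_trans _ _ (288 * n%:R^-1 + n%:R `^ (- 6^-1) * 24)); last first.
  by move: ninv; set x := _ `^ _; set y := _^-1; lra.
apply: lerD; last by rewrite ler_wpM2l ?powR_ge0 // (ler_nat _ _ 24).
rewrite -[leLHS]mulr_natr -[n.+1%:R]natr1; have n1 : 1 <= n%:R :> R by rewrite ler1n; lia.
have -> : 144 / n%:R ^+ 2 * (n%:R + 1) = (144 * (1 + n%:R^-1)) * n%:R^-1 :> R.
  by field; rewrite gt_eqF.
rewrite ler_pM2r ?invr_gt0 //; have : n%:R^-1 <= 1 :> R by rewrite invf_le1.
by lra.
Qed.

Lemma configs_gt0 : (0 < #|configs d|)%N.
Proof.
have [|M MP] := @pairing_exists (half_edge d) setT.
  by rewrite cardsT card_half_edge.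
by apply/card_gt0P; exists M.
Qed.

(** Each set of size [s] is bad with probability at most [tail_weight s / 'C(n, s)]; there are
    ['C(n, s)] sets of that size, so only the weights remain to be summed. *)
Lemma uprob_expanding :
  1 - 312 * n%:R `^ (- 6^-1) <= uprob R (configs d) (expanding d).
Proof.
have pm0 : 0 < #|configs d|%:R :> R by rewrite ltr0n configs_gt0.
pose adm (S : {set 'I_n}) :=
  (S != set0) && (#|half_edges_of d S| * 2 <= #|half_edge d|)%N.
pose bad S := [set M in configs d |
  (100 * cut M (half_edges_of d S) <= #|half_edges_of d S|)%N].
have bad_le S : adm S ->
    #|bad S|%:R <= #|configs d|%:R * (tail_weight #|S| / 'C(n, #|S|)%:R) :> R.
  move=> /andP[S0 S2]; have := card_few_cut_vertices d3 S2; rewrite -/(bad S).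
  rewrite -(ler_nat R) natrM !natrX => h.
  (* The full vertex set is inadmissible: it carries all half-edges, and there is at least one. *)
  have sn : (0 < #|S| < n)%N.
    rewrite card_gt0 S0 /= ltnNge; apply/negP => nS.
    have ST : S = setT by apply/eqP; rewrite eqEcard subsetT cardsT card_ord.
    move: S2; rewrite card_half_edges_of card_half_edge ST.
    rewrite (_ : \sum_(v in setT) d v = \sum_(v < n) d v)%N; last first.
      by apply: eq_bigl => v; rewrite inE.
    have : (n * 3 <= \sum_(v < n) d v)%N.
      by rewrite -[n in (n * 3)%N]card_ord -sum_nat_const leq_sum.
    lia.
  have C0 : 0 < 'C(n, #|S|)%:R :> R by rewrite ltr0n bin_gt0; lia.
  have t0 := tail_weight_gt0 #|S|.
  (* In sixth powers, [b ^ 6 * C ^ 7 <= p ^ 6] and [1 <= t ^ 6 * C] give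
     [(b * C) ^ 6 <= (p * t) ^ 6]. *)
  rewrite mulrA ler_pdivlMr // -(@ler_pXn2r _ 6) ?nnegrE ?mulr_ge0 ?ler0n ?(ltW t0) //.
  have := tail_weight_bin sn; move: h C0 pm0 t0.
  set b := #|bad S|%:R; set C := _%:R; set p := #|_|%:R; set t := tail_weight _.
  move=> h C0 p0 t0 tC; rewrite !exprMn -(ler_pM2r C0).
  rewrite -mulrA -exprSr; apply: (le_trans h).
  by rewrite -mulrA ler_peMr // exprn_ge0 // ltW.
rewrite /uprob ler_pdivlMr // mulrBl mul1r lerBlDr.
rewrite -[in leLHS](cardsID (expanding d) (configs d)) natrD lerD2l.
apply: (@le_trans _ _ (\sum_(S | adm S) #|bad S|%:R)).
  rewrite -natr_sum ler_nat; apply: leq_trans (card_bigcup_le _ _).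
  apply/subset_leq_card/subsetP => M; rewrite inE [M \in expanding d]inE => /andP[/forallPn[S]].
  rewrite negb_imply -leqNgt => /andP[admS badS] MP.
  by apply/bigcupP; exists S => //; rewrite inE MP.
apply: (le_trans (ler_sum _ bad_le)); rewrite -mulr_sumr mulrC ler_pM2r //.
apply: le_trans sum_tail_weight.
apply: (@le_trans _ _ (\sum_(S : {set 'I_n}) (tail_weight #|S| / 'C(n, #|S|)%:R))).
  rewrite big_mkcond; apply: ler_sum => S _; case: ifP => // _.
  by rewrite divr_ge0 // ltW // tail_weight_gt0.
have cS (S : {set 'I_n}) : (#|S| < n.+1)%N by rewrite ltnS -[n in leqRHS]card_ord max_card.
rewrite (partition_big (fun S => Ordinal (cS S)) predT) //=.
apply: ler_sum => s _; rewrite (eq_bigr (fun=> tail_weight s / 'C(n, s)%:R)); last first.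
  by move=> S /eqP <-.
rewrite (eq_bigl (mem [set S : {set 'I_n} | #|S| == s])); last first.
  by move=> S; rewrite !inE -val_eqE.
rewrite sumr_const card_draws card_ord -[leLHS]mulr_natr mulfVK // pnatr_eq0 -lt0n bin_gt0.
by rewrite -ltnS.
Qed.

End ExpansionProbability.

(** * Simple configurations over a graph as edge labellings *)

Section Fibres.
Import boot.fintype boot.finset.
Variables (n : nat) (d : 'I_n -> nat).
Local Open Scope nat_scope.
Local Open Scope set_scope.
Implicit Types (M : pairing d) (G : graph n) (S : {set 'I_n}).

Definition simple_configs : {set pairing d} := configs d :&: maps_to_simple d.

Definition graph_of M : graph n := [set ends p | p in M].

Definition fibre G : {set pairing d} := [set M in simple_configs | graph_of M == G].

(** Injectivity at each vertex becomes bijectivity when [G] has degrees [d]; see [labeling_onto]. *)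
Definition labelings G : {set {ffun half_edge d -> {set 'I_n}}} :=
  [set f : {ffun half_edge d -> {set 'I_n}} |
    [forall h, (f h \in G) && (tag h \in f h)] &&
    [forall h, forall h', (tag h == tag h') && (f h == f h') ==> (h == h')]].

Definition edge_at M : {ffun half_edge d -> {set 'I_n}} :=
  [ffun h => ends (pblock M h)].

Lemma labelingsP G (f : {ffun half_edge d -> {set 'I_n}}) :
  reflect [/\ forall h, f h \in G, forall h, tag h \in f h &
              forall h h', tag h = tag h' -> f h = f h' -> h = h']
          (f \in labelings G).
Proof.
rewrite inE; apply: (iffP andP) => [[/forallP h1 /forallP h2]|[h1 h2 h3]].
  split=> h; try by have /andP[] := h1 h.
  move=> h' e1 e2; have /forallP /(_ h') := h2 h.
  by rewrite e1 e2 !eqxx => /eqP.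
split; apply/forallP => h; first by rewrite h1 h2.
by apply/forallP => h'; apply/implyP => /andP[/eqP e1 /eqP e2]; rewrite (h3 h h').
Qed.

Lemma simple_configsP M : reflect
  [/\ partition M setT, {in M, forall p : {set half_edge d}, #|p| = 2},
      {in M, forall p : {set half_edge d}, #|ends p| = 2} & {in M &, injective (@ends n d)}]
  (M \in simple_configs).
Proof.
rewrite inE [M \in maps_to_simple d]inE.
apply: (iffP and3P) => [[/pairingsP[PM cM] /forall_inP eM /dinjectiveP iM]|[PM cM eM iM]].
  by split => // p pM; apply/eqP/eM.
split; [exact/pairingsP|apply/forall_inP => p pM; exact/eqP/eM|exact/dinjectiveP].
Qed.

Lemma half_edge_pblock M h : M \in simple_configs -> pblock M h \in M /\ h \in pblock M h.
Proof.
by move=> /simple_configsP[PM _ _ _]; rewrite pblock_mem ?mem_pblock (cover_partition PM) inE.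
Qed.

Lemma edge_at_eq M h h' : M \in simple_configs ->
  (edge_at M h == edge_at M h') = (pblock M h == pblock M h').
Proof.
move=> sM; have /simple_configsP[_ _ _ iM] := sM; rewrite !ffunE.
apply/eqP/eqP => [|->//]; apply: iM; exact: (half_edge_pblock _ sM).1.
Qed.

(** Without parallel edges, equal labels put two half-edges in the same pair; without loops, [tag]
    is injective on that pair. *)
Lemma edge_at_labeling M : M \in simple_configs -> edge_at M \in labelings (graph_of M).
Proof.
move=> sM; have /simple_configsP[PM cM eM iM] := sM; apply/labelingsP.
split=> [h|h|h h' e1 /eqP].
- by rewrite ffunE imset_f // (half_edge_pblock h sM).1.
- by rewrite ffunE imset_f // (half_edge_pblock h sM).2.
rewrite edge_at_eq // => /eqP e2.
have /imset_injP tag_inj : #|ends (pblock M h)| == #|pblock M h|.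
  by rewrite eM ?cM // (half_edge_pblock _ sM).1.
apply: tag_inj => //; first by rewrite (half_edge_pblock _ sM).2.
by rewrite e2 (half_edge_pblock _ sM).2.
Qed.

(** The pairs of [M] are the classes of half-edges with equal label. *)
Lemma edge_at_inj : {in simple_configs &, injective edge_at}.
Proof.
move=> M M' sM sM' e.
have /simple_configsP[PM _ _ _] := sM; have /simple_configsP[PM' _ _ _] := sM'.
rewrite -(preim_partition_pblock PM) -(preim_partition_pblock PM').
apply: eq_imset => h; apply/setP => h'; rewrite !inE /=.
by rewrite -!edge_at_eq // e.
Qed.

Lemma card_tag_fibre v : #|[set h : half_edge d | tag h == v]| = d v.
Proof.
have := card_half_edges_of d [set v]; rewrite big_set1 => <-.
by apply: eq_card => h; rewrite !inE.
Qed.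

Lemma labeling_inj G f v : f \in labelings G ->
  {in [set h : half_edge d | tag h == v] &, injective f}.
Proof.
move=> /labelingsP[_ _ fi] h h'; rewrite !inE => /eqP e /eqP e'.
by apply: fi; rewrite e.
Qed.

Section LabelingConfig.
Variables (G : graph n) (f : {ffun half_edge d -> {set 'I_n}}).
Hypotheses (GG : G \in graphs_of_degrees d) (fG : f \in labelings G).

(** The labels at [v] are [d v] distinct edges of [G] at [v], and [G] has exactly [d v] of them. *)
Lemma labeling_onto v e : e \in G -> v \in e -> exists2 h, tag h = v & f h = e.
Proof.
move=> eG ve; have /labelingsP[h1 h2 _] := fG.
have E : f @: [set h | tag h == v] = [set e in G | v \in e].
  apply/eqP; rewrite eqEcard; apply/andP; split.
    by apply/subsetP => e' /imsetP[h]; rewrite inE => /eqP <- ->; rewrite inE h1 h2.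
  rewrite (card_in_imset (labeling_inj fG)) card_tag_fibre.
  by move: GG; rewrite inE => /andP[_ /forallP/(_ v)/eqP<-].
have : e \in [set e in G | v \in e] by rewrite inE eG.
by rewrite -E => /imsetP[h]; rewrite inE => /eqP; exists h.
Qed.

Let block h := [set h' | f h' == f h].

Lemma ends_block h : ends (block h) = f h.
Proof.
have /labelingsP[h1 h2 _] := fG.
apply/setP => v; apply/imsetP/idP => [[h' ] | vf].
  by rewrite inE => /eqP <- ->.
by have [h' <- e] := labeling_onto (h1 h) vf; exists h'; rewrite // inE e.
Qed.

(** The inverse of [edge_at]: equally labelled half-edges are paired. *)
Definition config_of_labeling : pairing d := preim_partition f setT.

Lemma config_of_labelingE : config_of_labeling = [set block h | h in setT].
Proof.
by apply: eq_imset => h; apply/setP => h'; rewrite !inE eq_sym.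
Qed.

Lemma config_of_labeling_simple : config_of_labeling \in simple_configs.
Proof.
have /labelingsP[h1 h2 h3] := fG.
have f2 h : #|f h| = 2.
  by move: GG; rewrite inE => /andP[/forall_inP/(_ _ (h1 h))/eqP].
apply/simple_configsP; split; first exact: preim_partitionP.
all: rewrite config_of_labelingE.
(* [tag] maps the block of [h] bijectively onto the two vertices of the edge [f h]. *)
- move=> _ /imsetP[h _ ->]; rewrite -(f2 h) -ends_block card_in_imset //.
  by move=> x y; rewrite !inE => /eqP ex /eqP ey exy; apply: h3; rewrite ?ex.
- by move=> _ /imsetP[h _ ->]; rewrite ends_block.
by move=> _ _ /imsetP[h _ ->] /imsetP[h' _ ->]; rewrite !ends_block /block => ->.
Qed.

Lemma graph_of_config_of_labeling : graph_of config_of_labeling = G.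
Proof.
have /labelingsP[h1 _ _] := fG.
apply/setP => e; rewrite /graph_of config_of_labelingE.
apply/imsetP/idP => [[_ /imsetP[h _ ->] ->]|eG]; first by rewrite ends_block.
have /card_gt0P[v ve] : 0 < #|e|.
  by move: GG; rewrite inE => /andP[/forall_inP/(_ _ eG)/eqP->].
have [h _ fh] := labeling_onto eG ve.
by exists (block h); rewrite ?imset_f ?inE // ends_block.
Qed.

Lemma edge_at_config_of_labeling : edge_at config_of_labeling = f.
Proof.
apply/ffunP => h; rewrite ffunE -ends_block; congr ends.
apply: def_pblock.
- exact: partition_trivIset (preim_partitionP f setT).
- by rewrite config_of_labelingE imset_f ?inE.
by rewrite inE.
Qed.

End LabelingConfig.

Lemma card_fibre G : G \in graphs_of_degrees d -> #|fibre G| = #|labelings G|.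
Proof.
move=> GG; have inj : {in fibre G &, injective edge_at}.
  move=> M M'; rewrite [M \in _]inE [M' \in _]inE => /andP[sM _] /andP[sM' _].
  exact: edge_at_inj.
rewrite -(card_in_imset inj); apply: eq_card => f.
apply/imsetP/idP => [[M MG ->]|fG].
  by move: MG; rewrite inE => /andP[sM /eqP <-]; apply: edge_at_labeling.
exists (config_of_labeling f); last by rewrite (edge_at_config_of_labeling GG fG).
by rewrite inE (config_of_labeling_simple GG fG) (graph_of_config_of_labeling GG fG) /=.
Qed.

End Fibres.

(** * Degrees, cuts and conductance of the image graph *)

Section SimpleImage.
Import boot.fintype boot.finset.
Variables (n : nat) (d : 'I_n -> nat).
Local Open Scope set_scope.
Implicit Types (M : pairing d) (G : graph n) (S : {set 'I_n}).

Lemma deg_graph_of M v : M \in simple_configs d -> deg (graph_of M) v = d v.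
Proof.
move=> sM; have fG := edge_at_labeling sM.
have /labelingsP[h1 h2 _] := fG.
rewrite -(card_tag_fibre d v) -(card_in_imset (labeling_inj fG)); apply: eq_card => e.
rewrite inE; apply/andP/imsetP => [[/imsetP[p pM ->] /imsetP[h hp ->]]|[h]].
  exists h; rewrite ?inE // ffunE; congr ends; apply/esym.
  have /simple_configsP[PM _ _ _] := sM.
  exact: def_pblock (partition_trivIset PM) pM hp.
by rewrite inE => /eqP <- ->.
Qed.

Lemma graph_of_degrees M : M \in simple_configs d -> graph_of M \in graphs_of_degrees d.
Proof.
move=> sM; have /simple_configsP[_ _ eM _] := sM.
rewrite inE; apply/andP; split.
  by apply/forall_inP => e /imsetP[p pM ->]; rewrite eM.
by apply/forallP => v; rewrite deg_graph_of.
Qed.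

Lemma vol_graph_of M S : M \in simple_configs d ->
  vol (graph_of M) S = #|half_edges_of d S|.
Proof.
move=> sM; rewrite card_half_edges_of; apply: eq_bigr => v _; exact: deg_graph_of.
Qed.

Lemma ends_meet (p : {set half_edge d}) S :
  (ends p :&: S != set0) = (p :&: half_edges_of d S != set0).
Proof.
apply/set0Pn/set0Pn => [[_ /setIP[/imsetP[h hp ->] hS]]|[h /setIP[hp]]].
  by exists h; rewrite !inE hp.
by rewrite inE => hS; exists (tag h); rewrite inE hS imset_f.
Qed.

Lemma half_edges_ofC S : half_edges_of d (~: S) = ~: half_edges_of d S.
Proof. by apply/setP => h; rewrite !inE. Qed.

(** [ends] is injective on a simple configuration, and a pair meets the half-edges of [S] exactly
    when its edge meets [S]. *)
Lemma crossing_graph_of M S : M \in simple_configs d ->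
  crossing (graph_of M) S = cut M (half_edges_of d S).
Proof.
move=> sM; have /simple_configsP[_ _ _ iM] := sM.
rewrite /cut -(card_in_imset (f := @ends n d)); last first.
  by move=> p q; rewrite inE => /andP[pM _]; rewrite inE => /andP[qM _]; apply: iM.
apply: eq_card => e; rewrite inE.
apply/andP/imsetP => [[/imsetP[p pM ->]]|[p + ->]].
  by rewrite !ends_meet half_edges_ofC => h; exists p; rewrite // inE pM.
by rewrite inE => /andP[pM]; rewrite !ends_meet half_edges_ofC imset_f.
Qed.

Lemma card_graph_of M : M \in simple_configs d -> (2 * #|graph_of M| = #|half_edge d|)%N.
Proof.
move=> sM; have /simple_configsP[PM cM _ iM] := sM.
by rewrite card_in_imset // -cardsT (card_uniform_partition cM PM) mulnC.
Qed.

Lemma conductance_graph_of (R : realType) M : (forall v, (3 <= d v)%N) ->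
  M \in simple_configs d -> M \in expanding d ->
  100^-1 < conductance R (graph_of M).
Proof.
move=> d3 sM; rewrite inE => /forallP eM.
(* The bound is checked for the seed 1 and for each admissible ratio. *)
rewrite /conductance; elim/big_ind: _ => [|x y hx hy|S /andP[S0 hS]].
- by lra.
- by rewrite lt_min hx hy.
have vol0 : (0 < vol (graph_of M) S)%N.
  have /set0Pn[v vS] := S0; rewrite vol_graph_of // card_half_edges_of (bigD1 v) //=.
  by rewrite addn_gt0 (leq_trans _ (d3 v)).
rewrite /edge_ratio ltr_pdivlMr ?ltr0n // mulrC ltr_pdivrMr // -natrM ltr_nat.
rewrite crossing_graph_of // vol_graph_of // mulnC; have /implyP := eM S; apply.
rewrite S0 /=; move: hS; rewrite card_graph_of // vol_graph_of //.
rewrite vol_graph_of // in vol0; rewrite ler_pdivrMr; last first.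
  by rewrite ltr0n (leq_trans vol0) ?max_card.
by rewrite -(ler_nat R) natrM; lra.
Qed.

End SimpleImage.

(** * From simple configurations to uniform graphs *)

Section Transfer.
Import boot.fintype boot.finset.
Variables (R : realType) (n : nat) (d : 'I_n -> nat).
Local Open Scope set_scope.

(** At each vertex [v], [r v] matches the edges of [G] with those of [G'] by rank in their
    enumerations; relabelling by [r] is injective on labellings. *)
Lemma card_fibre_le (G G' : graph n) : G \in graphs_of_degrees d ->
  G' \in graphs_of_degrees d -> (#|fibre d G| <= #|fibre d G'|)%N.
Proof.
move=> GG GG'; rewrite !card_fibre //.
have degG H v : H \in graphs_of_degrees d -> #|[set e in H | v \in e]| = d v.
  by rewrite inE => /andP[_ /forallP/(_ v)/eqP].
pose E (H : graph n) v := enum [set e in H | v \in e].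
pose r v e := nth set0 (E G' v) (index e (E G v)).
have rP (f : {ffun half_edge d -> {set 'I_n}}) h : f \in labelings d G ->
    r (tag h) (f h) \in [set e in G' | tag h \in e].
  move=> /labelingsP[h1 h2 _]; rewrite -mem_enum mem_nth // -cardE degG //.
  by rewrite -(degG G) // cardE index_mem mem_enum inE h1 h2.
have r_inj v : {in [set e in G | v \in e] &, injective (r v)}.
  move=> e e' eG e'G /eqP; rewrite nth_uniq ?enum_uniq //; last 2 first.
  - by rewrite -cardE degG // -(degG G) // cardE index_mem mem_enum.
  - by rewrite -cardE degG // -(degG G) // cardE index_mem mem_enum.
  by move=> /eqP; apply: (index_inj set0); rewrite mem_enum.
pose F (f : {ffun half_edge d -> {set 'I_n}}) := [ffun h => r (tag h) (f h)].
have F_inj : {in labelings d G &, injective F}.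
  move=> f f' fG f'G /ffunP e; apply/ffunP => h; have := e h; rewrite !ffunE.
  have /labelingsP[h1 h2 _] := fG; have /labelingsP[h1' h2' _] := f'G.
  by apply: r_inj; rewrite inE ?h1 ?h1' ?h2 ?h2'.
rewrite -(card_in_imset F_inj); apply/subset_leq_card/subsetP => _ /imsetP[f fG ->].
have /labelingsP[h1 h2 h3] := fG.
apply/labelingsP; split=> [h|h|h h' e].
- by rewrite ffunE; have := rP f h fG; rewrite inE => /andP[].
- by rewrite ffunE; have := rP f h fG; rewrite inE => /andP[].
rewrite !ffunE e => /r_inj e2; apply: h3 => //.
by apply: e2; rewrite inE ?h1 ?h2 // -e h2.
Qed.

(** All fibres have the same size [l], which cancels from the quotient. In the degenerate cases the
    convention [0 / 0 = 0] makes the left side zero. *)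
Lemma uprob_graphs_ge (A : {set pairing d}) (B : {set graph n}) :
  (forall M, M \in simple_configs d -> M \in A -> graph_of M \in B) ->
  cond_uprob R (configs d) A (maps_to_simple d) <= uprob R (graphs_of_degrees d) B.
Proof.
move=> AB; have [G0 G0G|no] := pickP (mem (graphs_of_degrees d)); last first.
  have s0 : simple_configs d = set0.
    apply/setP => M; rewrite in_set0; apply/negP => sM.
    by have := no (graph_of M); rewrite inE graph_of_degrees.
  rewrite /cond_uprob /uprob -[configs d :&: maps_to_simple d]/(simple_configs d) s0.
  by rewrite cards0 mul0r invr0 mulr0 divr_ge0.
set l := #|fibre d G0|.
have cl G : G \in graphs_of_degrees d -> #|fibre d G| = l.
  by move=> GG; apply/eqP; rewrite eqn_leq !card_fibre_le.
have sumfib (X : {set graph n}) :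
    #|[set M in simple_configs d | graph_of M \in X]| = (#|graphs_of_degrees d :&: X| * l)%N.
  rewrite -sum1_card (partition_big (fun M => graph_of M) (mem (graphs_of_degrees d :&: X))) /=.
    rewrite -sum_nat_const; apply: eq_bigr => G; rewrite inE => /andP[GG GX].
    rewrite -(cl G GG) -sum1_card; apply: eq_bigl => M.
    rewrite [M \in fibre _ _]inE inE -andbA; congr andb.
    by case: eqP => [->|]; rewrite ?GX ?andbF.
  by move=> M; rewrite inE => /andP[sM MX]; rewrite inE graph_of_degrees.
have sE : #|simple_configs d| = (#|graphs_of_degrees d| * l)%N.
  rewrite -[graphs_of_degrees d]setIT -sumfib; apply: eq_card => M.
  by rewrite [in RHS]inE [_ \in setT]inE andbT.
have sA : (#|configs d :&: (A :&: maps_to_simple d)| <= #|graphs_of_degrees d :&: B| * l)%N.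
  rewrite -sumfib; apply/subset_leq_card/subsetP => M.
  move=> /setIP[Mc /setIP[MA Ms]].
  have sM : M \in simple_configs d by apply/setIP.
  by rewrite inE sM AB.
have [N0|N0] := eqVneq #|configs d| 0%N.
  by rewrite /cond_uprob /uprob N0 invr0 !mulr0 invr0 mulr0 divr_ge0.
rewrite /cond_uprob /uprob -[configs d :&: maps_to_simple d]/(simple_configs d).
rewrite -mulf_div divff ?invr_eq0 ?pnatr_eq0 // mulr1 sE.
have [l0|l0] := posnP l; first by rewrite l0 muln0 invr0 mulr0 divr_ge0.
have g0 : (0 < #|graphs_of_degrees d|)%N by apply/card_gt0P; exists G0.
rewrite ler_pdivrMr ?ltr0n ?muln_gt0 ?g0 // natrM mulrA divfK ?pnatr_eq0 -?lt0n //.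
by rewrite -natrM ler_nat.
Qed.

End Transfer.

(** * Passage to the limit *)

Lemma le_powR_inv (R : realType) (K x : R) (k : nat) : (0 < k)%N ->
  0 <= K -> K ^+ k <= x -> K <= x `^ (k%:R^-1).
Proof.
move=> k0 K0 Kx.
have -> : K = (K ^+ k) `^ (k%:R^-1).
  by rewrite -powR_mulrn // -powRrM mulfV ?pnatr_eq0 -?lt0n // powRr1.
by rewrite ge0_ler_powR ?invr_ge0 ?nnegrE ?exprn_ge0 // (le_trans _ Kx) ?exprn_ge0.
Qed.

Theorem theorem54 (R : realType) (zeta : R) (zeta_gt0 : 0 < zeta)
    (zeta_lt : zeta < 3^-1)
    (d : forall n : nat, 'I_n -> nat) (m : nat -> nat)
    (sum_deg : \forall n \near \oo, (\sum_(i < n) d n i = 2 * m n)%N)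
    (min_deg : \forall n \near \oo, forall i : 'I_n, (3 <= d n i)%N)
    (avg_deg : \forall n \near \oo,
       (2 * m n)%:R / n%:R <= (n%:R : R) `^ zeta)
    (transfer : transfers_to_simple R d) :
  uprob R (graphs_of_degrees (d n))
      [set G : graph n | (100^-1 < conductance R G)%R]%SET
    @[n --> \oo] --> (1 : R).
Proof.
have deg_even : \forall n \near \oo, ~~ odd (\sum_(i < n) d n i)%N.
  by near=> n; rewrite (near sum_deg n) // mul2n odd_double.
have expand : exists2 c : R, 0 < c & \forall n \near \oo,
    1 - n%:R `^ (- c) <= uprob R (configs (d n)) (expanding (d n)).
  (* Half of the exponent [1 / 6] is kept; the other half absorbs the constant 312 once
     [n >= 312 ^ 12]. *)
  exists 12^-1; first by rewrite invr_gt0.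
  near=> n.
  have n24 : (24 <= n)%N by near: n; exact: nbhs_infty_ge.
  have n_big : 312 <= n%:R `^ 12^-1 :> R.
    apply: (le_powR_inv (isT : 0 < 12)%N (ler0n R 312)).
    by near: n; exact: nbhs_infty_ger.
  have d3 : forall v, (3 <= d n v)%N by near: n.
  apply: le_trans (uprob_expanding R n24 d3 _); last by near: n.
  rewrite lerD2l lerN2.
  have n0 : 0 < n%:R :> R by rewrite ltr0n (leq_trans _ n24).
  have -> : - 6^-1 = - 12^-1 + - 12^-1 :> R by lra.
  rewrite powRD; last by rewrite (gt_eqF n0) implybT.
  by rewrite mulrA ler_piMl ?powR_ge0 // powRN ler_pdivrMr ?powR_gt0 // mul1r.
have cond_cvg := transfer _ expand.
(* The graph probability lies between the conditional probability of [expanding] and 1. *)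
apply: (@squeeze_cvgr _ _ _ _ _ (cst 1) _ _ _ cond_cvg); last exact: cvg_cst.
near=> n; have d3 : forall v, (3 <= d n v)%N by near: n.
apply/andP; split.
  apply: uprob_graphs_ge => M sM eM; rewrite inE.
  exact: conductance_graph_of.
rewrite /uprob; have [->|N0] := eqVneq #|graphs_of_degrees (d n)| 0%N.
  by rewrite invr0 mulr0.
rewrite ler_pdivrMr ?ltr0n ?lt0n // mul1r ler_nat.
exact/subset_leq_card/finset.subsetIl.
Unshelve. all: by end_near.
Qed.
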